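(* Let $n=2m+1\geq 3$ be an odd integer. (i) Let $U_n$ be the set of critical points of $\mu:X_n\to\mathbb{R}$. Then $$|U_n|=\frac12\left(-4^m+\frac{(2m+1)!}{(m!)^2}\right).$$ (ii) Let $V_n$ be the set of critical values of $\mu$. Set $$\Phi(n):=\frac12\sum_{s=1}^m\varphi(2s+1),$$ where $\varphi$ denotes Euler's totient function. Then $|V_n|=\Phi(n)$.
   Context: $|\cdot|$ denotes cardinality. $d(u,v)=\arccos(u\cdot v)$ denotes the spherical distance on the unit sphere $S^2\subset\mathbb{R}^3$. Set $$B_n:=\{((u_1,\dots,u_n),a)\in (S^2)^n\times(0,\pi) \mid d(u_i,u_{i+1})=a \text{ for } 1\leq i\leq n-1 \text{ and } d(u_n,u_1)=a\}.$$ $SO(3)$ acts on $B_n$ diagonally on the points $u_i$ and trivially on $a$, and $X_n:=B_n/SO(3)$. For odd $n$, $X_n$ is a smooth manifold of dimension $n-2$ (with $B_n$ regarded as a smooth submanifold of $(S^2)^n\times(0,\pi)$, on which $SO(3)$ acts freely). The smooth function $\mu:X_n\to\mathbb{R}$ is $\mu(P,a)=a$. *)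

(* Defs.v *)
From HB Require Import structures.
From mathcomp Require Import all_boot all_order all_algebra.
From mathcomp Require Import all_classical all_reals all_analysis.
Import numFieldNormedType.Exports.

Set Implicit Arguments.
Unset Strict Implicit.
Unset Printing Implicit Defensive.

Import Order.TTheory GRing.Theory Num.Theory.
Local Open Scope classical_set_scope.
Local Open Scope ring_scope.
Local Open Scope quotient_scope.

Definition dotv (R : realType) (u v : 'rV[R]_3) : R := \sum_k u 0 k * v 0 k.

Definition sphere2 (R : realType) : set 'rV[R]_3 := [set u | dotv u u = 1].

Definition sdist (R : realType) (u v : 'rV[R]_3) : R := acos (dotv u v).

Definition SO3 (R : realType) : set 'M[R]_3 :=
  [set A | A *m A^T = 1%:M /\ \det A = 1].

(* A tuple (u_1, ..., u_n) of vectors of R^3 is the matrix with rows u_i.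
   ordS is the cyclic successor on 'I_n, so that the last condition includes
   the closing edge from u_n to u_1. *)
Definition Bset (R : realType) (n : nat) : set ('M[R]_(n, 3) * R) :=
  [set p | [/\ forall i, sphere2 (row i p.1),
               0 < p.2 < pi
             & forall i, sdist (row i p.1) (row (ordS i) p.1) = p.2]].

Definition B (R : realType) (n : nat) : choiceType := set_type (@Bset R n).

(* g acts on column vectors on the left, hence on the rows of P by
   right multiplication by g^T. *)
Definition same_orbit (R : realType) (n : nat) (p q : B R n) : bool :=
  `[< exists2 g : 'M[R]_3, SO3 g &
        (val q).1 = (val p).1 *m g^T /\ (val q).2 = (val p).2 >].

Section Quotient.
Variables (R : realType) (n : nat).

Lemma SO3_1 : SO3 (1%:M : 'M[R]_3).
Proof. by split; [rewrite trmx1 mulmx1 | rewrite det1]. Qed.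

Lemma SO3_tr (g : 'M[R]_3) : SO3 g -> SO3 g^T.
Proof. by case=> gg dg; split; rewrite ?det_tr// trmxK; apply: mulmx1C. Qed.

Lemma SO3_mul (g h : 'M[R]_3) : SO3 g -> SO3 h -> SO3 (g *m h).
Proof.
move=> [gg dg] [hh dh]; split; last by rewrite det_mulmx dg dh mulr1.
by rewrite trmx_mul mulmxA -(mulmxA g) hh mulmx1.
Qed.

Lemma same_orbit_refl : reflexive (@same_orbit R n).
Proof.
move=> p; apply/asboolP; exists 1%:M; first exact: SO3_1.
by rewrite trmx1 mulmx1.
Qed.

Lemma same_orbit_impl (p q : B R n) : same_orbit p q -> same_orbit q p.
Proof.
move=> /asboolP[g Sg [e1 e2]]; apply/asboolP; exists g^T; first exact: SO3_tr.
case: (Sg) => gg _; rewrite e1 e2 trmxK -mulmxA.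
by rewrite (mulmx1C gg) mulmx1.
Qed.

Lemma same_orbit_sym : symmetric (@same_orbit R n).
Proof. by move=> p q; apply/idP/idP; exact: same_orbit_impl. Qed.

Lemma same_orbit_trans : transitive (@same_orbit R n).
Proof.
move=> q p r /asboolP[g Sg [e1 e2]] /asboolP[h Sh [f1 f2]].
apply/asboolP; exists (h *m g); first exact: SO3_mul.
by rewrite f1 e1 f2 e2 trmx_mul mulmxA.
Qed.

Canonical same_orbit_equiv :=
  EquivRel (@same_orbit R n) same_orbit_refl same_orbit_sym same_orbit_trans.

End Quotient.

Definition X (R : realType) (n : nat) := {eq_quot (same_orbit_equiv R n)}.

Definition mu (R : realType) (n : nat) (x : X R n) : R := (val (repr x)).2.

Lemma mu_pi (R : realType) (n : nat) (p : B R n) : mu (\pi_(X R n) p) = (val p).2.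
Proof.
rewrite /mu; have : same_orbit (repr (\pi_(X R n) p)) p.
  by apply/eqmodP; rewrite reprK.
by move=> /asboolP[g _ [_ ->]].
Qed.

Definition smooth_on (R : realType) (e : R) (f : R -> R) : Prop :=
  forall (k : nat) (t : R), `|t| < e -> derivable (derive1n k f) t 1.

(* B_n is a submanifold of R^(3n) x R, so a curve in it is smooth iff its
   ambient coordinates are. *)
Definition smooth_curve_B (R : realType) (n : nat) (e : R) (c : R -> B R n) :
    Prop :=
  (forall i k, smooth_on e (fun t => (val (c t)).1 i k)) /\
  smooth_on e (fun t => (val (c t)).2).

(* Smoothness near 0 of a curve in X_n.  The quotient map B_n -> X_n is a
   surjective submersion, so the smooth curves of X_n are exactly those
   which locally lift to smooth curves of B_n. *)
Definition smooth_curve_X (R : realType) (n : nat) (c : R -> X R n) : Prop :=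
  exists (e : R) (b : R -> B R n),
    [/\ 0 < e, smooth_curve_B e b
      & forall t, `|t| < e -> c t = \pi_(X R n) (b t)].

(* The differential of f at x vanishes: tangent vectors at x are the
   velocities c'(0) of the smooth curves c with c(0) = x, and df(c'(0)) is
   (f \o c)'(0). *)
Definition critical_point (R : realType) (n : nat) (f : X R n -> R)
    (x : X R n) : Prop :=
  forall c : R -> X R n, smooth_curve_X c -> c 0 = x ->
    is_derive (0 : R) 1 (f \o c) 0.

Definition U (R : realType) (n : nat) : set (X R n) :=
  [set x | critical_point (@mu R n) x].
Arguments U R n : clear implicits.

Definition V (R : realType) (n : nat) : set R := @mu R n @` U R n.
Arguments V R n : clear implicits.

(* Main.v *)
Require Import Defs.
From mathcomp Require Import all_boot all_order all_algebra.
From mathcomp Require Import all_classical all_reals all_analysis.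
From mathcomp Require Import ring lra zify.
Import numFieldNormedType.Exports.
Import Order.TTheory GRing.Theory Num.Theory.

(* The critical points are the classes of the polygons lying on a great circle.

   If u_(i+1) = cos a u_i + eps_i sin a (N x u_i) with eps_i = +-1, then for any
   curve through the polygon the numbers w_i = <u_i', N x u_i> satisfy
   w_(i+1) - w_i = eps_i a'; summing around the polygon gives
   (sum eps_i) a' = 0, and sum eps_i is odd.

   If the polygon is not planar, then det(u_1, u_j, u_n) <> 0 for some j, and a
   can be increased at unit speed: open every edge from a to a + t by rotating
   the rest of the chain about u_i x u_(i+1), then restore the closing
   condition by rotating the tail of the chain about u_j.  The closing condition
   reads x B + y C = D in the cosine x and sine y of that last rotation, and its
   solution through (1, 0) is smooth because C(0) = det(u_1, u_j, u_n) <> 0.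

   A planar polygon is determined up to SO(3) by the set A of its steps
   eps_i = 1, chosen so that k = sum eps_i > 0, and by a = 2 pi j / k with
   0 < 2 j < k.  Hence |U_n| = sum_A (k - 1) / 2, and the critical values
   correspond to the reduced fractions j / k < 1 / 2 with k odd, 3 <= k <= n. *)

Set Implicit Arguments.
Unset Strict Implicit.
Unset Printing Implicit Defensive.

(** * Counting *)

Section Counting.
Implicit Types m : nat.

(** The symmetry [i -> 2m + 1 - i] exchanges the two halves of the row, so each is half of
    [2 ^ (2m + 1)]. *)
Lemma sum_upper_bin m : \sum_(s < m.+1) 'C(m.*2.+1, m.+1 + s) = 4 ^ m.
Proof.
have tot : \sum_(i < m.*2.+2) 'C(m.*2.+1, i) = 2 ^ m.*2.+1.
  by rewrite (expnDn 1 1); apply: eq_bigr => i _; rewrite !exp1n !muln1.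
have E : m.*2.+2 = m.+1 + m.+1 by lia.
rewrite E big_split_ord /= in tot.
have low : \sum_(i < m.+1) 'C(m.*2.+1, i) = \sum_(s < m.+1) 'C(m.*2.+1, m.+1 + s).
  rewrite (reindex_inj rev_ord_inj); apply: eq_bigr => i _ /=.
  have := ltn_ord i; rewrite ltnS => leim.
  have -> : m.+1 - i.+1 = m.*2.+1 - (m.+1 + i) by lia.
  by rewrite bin_sub//; lia.
by move: tot; rewrite low addnn -mul2n expnS -mul2n expnM => /eqP; rewrite eqn_pmul2l// => /eqP.
Qed.

(** The sum telescopes: [(2s + 1) C(2m + 1, m + 1 + s)] is [2m + 1] times
    [C(2m, m + s) - C(2m, m + s + 1)]. *)
Lemma sum_upper_bin_weighted m :
  \sum_(s < m.+1) s.*2.+1 * 'C(m.*2.+1, m.+1 + s) = m.*2.+1 * 'C(m.*2, m).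
Proof.
suff h r : r <= m.+1 -> \sum_(s < r) s.*2.+1 * 'C(m.*2.+1, m.+1 + s)
    + m.*2.+1 * 'C(m.*2, m + r) = m.*2.+1 * 'C(m.*2, m).
  by rewrite -(h m.+1)// [in RHS]bin_small ?muln0 ?addn0//; lia.
elim: r => [|r IH] ler; first by rewrite big_ord0 addn0.
rewrite -(IH (ltnW ler)) big_ord_recr /= -addnA; congr (_ + _).
have := mul_bin_diag m.*2.+1 (m + r); have := mul_bin_down m.*2.+1 (m + r.+1).
rewrite /= -addSn addnS.
have -> : m.*2.+1 - (m + r).+1 = m - r by lia.
move=> -> ->; rewrite -mulnDl; congr (_ * _); lia.
Qed.

(** Sets are grouped by cardinality [p]. Truncated subtraction kills [p <= m], and [p = m + 1 + s]
    contributes [(2s + 1)./2 = s]. *)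
Lemma sum_excess m :
  \sum_(A : {set 'I_m.*2.+1}) (#|A|.*2 - m.*2.+1)./2 =
  \sum_(s < m.+1) s * 'C(m.*2.+1, m.+1 + s).
Proof.
have card_lt (A : {set 'I_m.*2.+1}) : #|A| < m.*2.+2.
  by rewrite ltnS -[X in _ <= X]card_ord max_card.
rewrite (partition_big (fun A => Ordinal (card_lt A)) xpredT)//=.
transitivity (\sum_(p < m.*2.+2) (p.*2 - m.*2.+1)./2 * 'C(m.*2.+1, p)).
  apply: eq_bigr => p _.
  rewrite (eq_bigr (fun=> (p.*2 - m.*2.+1)./2)); last by move=> A /eqP <-.
  rewrite sum_nat_const mulnC; congr (_ * _).
  have := card_draws 'I_m.*2.+1 p; rewrite card_ord cardsE => <-; exact: eq_card.
have -> : m.*2.+2 = m.+1 + m.+1 by lia.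
rewrite big_split_ord /= big1 ?add0n => [|i _].
  by apply: eq_bigr => i _; congr (_ * _); lia.
by have := ltn_ord i => ?; rewrite (_ : _./2 = 0)//; lia.
Qed.

(** Writing [2s = (2s + 1) - 1] turns twice the sum into the weighted sum minus the plain one,
    [(2m + 1) C(2m, m) - 4 ^ m]. *)
Lemma excess_closed_form m : ((\sum_(A : {set 'I_m.*2.+1}) (#|A|.*2 - m.*2.+1)./2)%:R
  = 2%:R^-1 * (- 4%:R ^+ m + ((2 * m + 1)`!)%:R / (m`!)%:R ^+ 2) :> rat)%R.
Proof.
rewrite sum_excess.
set N := (X in (X%:R)%R).
have NE : N.*2 + 4 ^ m = m.*2.+1 * 'C(m.*2, m).
  rewrite -sum_upper_bin -sum_upper_bin_weighted -mul2n big_distrr -big_split /=.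
  by apply: eq_bigr => s _; lia.
have F : (2 * m + 1)`! = m.*2.+1 * 'C(m.*2, m) * m`! ^ 2.
  have -> : 2 * m + 1 = m.*2.+1 by lia.
  rewrite factS -mulnA; congr muln.
  rewrite -(@bin_fact m.*2 m) -?addnn ?leq_addr// addnK.
  by rewrite expnS expn1.
have f0 : ((m`!)%:R != 0 :> rat)%R by rewrite pnatr_eq0 -lt0n fact_gt0.
rewrite F -NE natrM natrX mulfK ?expf_neq0// natrD natrX -muln2 natrM.
by field.
Qed.

Lemma coprime_refl k d : d <= k -> coprime k (k - d) = coprime k d.
Proof.
move=> ledk; have := subnK ledk; set e := (k - d) => <-.
by rewrite /coprime [in LHS]gcdnC gcdnDl [in RHS]gcdnC gcdnDr gcdnC.
Qed.

(** The map [d -> 2s + 1 - d] preserves coprimality to [2s + 1] and exchanges [[1, s]] with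
    [[s + 1, 2s]]. *)
Lemma half_totient s : 0 < s ->
  totient (2 * s + 1) = (size [seq j <- iota 1 s | coprime s.*2.+1 j]).*2.
Proof.
move=> s0; rewrite totient_count_coprime (_ : 2 * s + 1 = s.*2.+1); last by lia.
have -> : size [seq j <- iota 1 s | coprime s.*2.+1 j] =
    \sum_(1 <= d < s.+1) coprime s.*2.+1 d.
  by rewrite size_filter -sum1_count big_mkcond /index_iota subn1; apply: eq_bigr => d _; case: coprime.
rewrite big_ltn// (_ : coprime _ 0 = false); last by rewrite /coprime gcdn0; lia.
rewrite add0n (@big_cat_nat _ _ _ s.+1)//=; last by lia.
rewrite -[RHS]addnn; congr (_ + _).
rewrite big_nat_rev /= -[in LHS](add1n s) (big_addn 1 _ s).
rewrite (_ : s.*2.+1 - s = s.+1); last by lia.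
rewrite !big_nat; apply: eq_bigr => d /andP[d1 ds].
rewrite (_ : _ - _ = s.*2.+1 - d); last by lia.
by rewrite coprime_refl//; lia.
Qed.

End Counting.

Local Open Scope classical_set_scope.
Local Open Scope ring_scope.

(** * Smooth functions *)

Section Smooth.
Variables (R : realType) (e : R).
Implicit Types (f g : R -> R) (k : nat).

(* Quantifying the derivatives existentially makes only the values on
   [`|t| < e] matter. *)
Fixpoint Ck k f : Prop :=
  if k is k'.+1 then
    exists2 g : R -> R, (forall t : R, `|t| < e -> is_derive t 1 f (g t)) & Ck k' g
  else True.

Definition Csm f := forall k, Ck k f.

Lemma near_norm_lt (t : R) : `|t| < e -> \forall s \near t, `|s| < e.
Proof. by move=> te; apply: (@cvgr_norm_lt _ R^o _ (nbhs t) _ id t) te; exact: cvg_id. Qed.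

Lemma eq_Ck k f g : (forall t, `|t| < e -> f t = g t) -> Ck k f -> Ck k g.
Proof.
case: k => // k fg [f' df Cf']; exists f' => // t te.
apply: near_eq_is_derive (df t te).
by near=> s; apply: fg; near: s; exact: near_norm_lt.
Unshelve. all: by end_near. Qed.

Lemma CkW k f : Ck k.+1 f -> Ck k f.
Proof.
elim: k f => // k IH f [g df Cg]; exists g => //; exact: IH.
Qed.

(** [iterSr] peels off the innermost derivative, which agrees with the witness [g] on the interval;
    the induction continues with [g]. *)
Lemma smooth_onP f : Csm f -> smooth_on e f.
Proof.
move=> Cf k t te; have := Cf k.+1; elim: k f {Cf} t te => [|k IH] f t te.
  by case=> g df _; case: (df t te).
case=> g df Cg; rewrite /derive1n iterSr; apply: IH => //.
apply: (@eq_Ck k.+1 g _ _ Cg) => s se; rewrite derive1E.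
  by case: (df s se) => _ ->.
Qed.

Lemma Ck_cst k c : Ck k (fun=> c).
Proof.
elim: k c => // k IH c; exists (fun=> 0) => // t _; exact: is_derive_cst.
Qed.

Lemma Ck_id k : Ck k (fun t => t).
Proof.
by case: k => // k; exists (fun=> 1); [move=> t _; exact: is_derive_id|exact: Ck_cst].
Qed.

Lemma CkD k f g : Ck k f -> Ck k g -> Ck k (fun t => f t + g t).
Proof.
elim: k f g => // k IH f g [f' df Cf] [g' dg Cg].
exists (fun t => f' t + g' t); last exact: IH.
by move=> t te; have := df t te; have := dg t te => ? ?; exact: is_deriveD.
Qed.

Lemma CkM k f g : Ck k f -> Ck k g -> Ck k (fun t => f t * g t).
Proof.
elim: k f g => // k IH f g Cf Cg.
have [f' df Cf'] := Cf; have [g' dg Cg'] := Cg.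
exists (fun t => f t * g' t + g t * f' t).
  by move=> t te; have := df t te; have := dg t te => ? ?; exact: is_deriveM.
by apply: CkD; apply: IH => //; exact: CkW.
Qed.

Lemma CkN k f : Ck k f -> Ck k (fun t => - f t).
Proof.
move=> Cf; apply: (@eq_Ck _ (fun t => -1 * f t)).
  by move=> t _; rewrite mulN1r.
by apply: CkM => //; exact: Ck_cst.
Qed.

(** The derivative [- f' / f ^ 2] involves [1 / f] only at order [k], so the induction closes.
    [Ck_sqrt] works the same way. *)
Lemma CkV k f : (forall t, `|t| < e -> f t != 0) -> Ck k f ->
  Ck k (fun t => (f t)^-1).
Proof.
move=> f0; elim: k => // k IH Cf; have [f' df Cf'] := Cf.
exists (fun t => - (f t)^-1 * (f t)^-1 * f' t).
  move=> t te; have := df t te => ?; apply: is_derive_eq.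
    by apply: is_deriveV => //; exact: f0.
  by rewrite -[_ *: _]/(_ * _) expr2 invfM !mulNr.
have CV := IH (CkW Cf).
by apply: CkM => //; apply: CkM => //; exact: CkN.
Qed.

Lemma Ck_sqrt k f : (forall t, `|t| < e -> 0 < f t) -> Ck k f ->
  Ck k (fun t => Num.sqrt (f t)).
Proof.
move=> f0; elim: k => // k IH Cf; have [f' df Cf'] := Cf.
exists (fun t => (2 * Num.sqrt (f t))^-1 * f' t).
  move=> t te; have := df t te => ?.
  by apply: (@is_derive1_comp _ Num.sqrt f); exact/is_derive1_sqrt/f0.
apply: CkM => //; apply: CkV.
  by move=> t te; rewrite mulf_neq0// ?pnatr_eq0// gt_eqF// sqrtr_gt0 f0.
by apply: CkM; [exact: Ck_cst | exact: IH (CkW Cf)].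
Qed.

Lemma Ck_cos_sin k : Ck k (@cos R) /\ Ck k (@sin R).
Proof.
elim: k => // k [IHc IHs]; split.
  by exists (fun t => - sin t); [move=> t _; exact: is_derive_cos | exact: CkN].
by exists cos => // t _; exact: is_derive_sin.
Qed.

End Smooth.

(** * Vectors of R^3 *)

Definition k0 : 'I_3 := @Ordinal 3 0 isT.
Definition k1 : 'I_3 := @Ordinal 3 1 isT.
Definition k2 : 'I_3 := @Ordinal 3 2 isT.

Lemma I3P (P : 'I_3 -> Prop) : P k0 -> P k1 -> P k2 -> forall k, P k.
Proof.
move=> P0 P1 P2 [[|[|[|//]]] i].
- by have -> : Ordinal i = k0 by exact: val_inj.
- by have -> : Ordinal i = k1 by exact: val_inj.
- by have -> : Ordinal i = k2 by exact: val_inj.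
Qed.

Section Vectors.
Variable R : realType.
Implicit Types (u v w N : 'rV[R]_3) (a x y z : R).

Definition vec3 x y z : 'rV[R]_3 := \row_k nth 0 [:: x; y; z] k.

Definition cross u v : 'rV[R]_3 :=
  vec3 (u 0 k1 * v 0 k2 - u 0 k2 * v 0 k1)
       (u 0 k2 * v 0 k0 - u 0 k0 * v 0 k2)
       (u 0 k0 * v 0 k1 - u 0 k1 * v 0 k0).

(** Rodrigues' formula: for unit [N] and [(x, y) = (cos t, sin t)] this is the rotation by [t] about
    [N]. Cosine and sine are separate arguments because [swing] obtains them algebraically, without
    an angle. *)
Definition axrot N x y v : 'rV[R]_3 :=
  dotv v N *: N + x *: (v - dotv v N *: N) + y *: cross N v.

Lemma vec3E x y z :
  (vec3 x y z 0 k0 = x) * (vec3 x y z 0 k1 = y) * (vec3 x y z 0 k2 = z).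
Proof. by rewrite !mxE. Qed.

Lemma sum3E (F : 'I_3 -> R) : \sum_k F k = F k0 + F k1 + F k2.
Proof.
rewrite !big_ord_recl big_ord0 addr0 addrA.
by congr (F _ + F _ + F _); exact: val_inj.
Qed.

Lemma dotvE u v : dotv u v = u 0 k0 * v 0 k0 + u 0 k1 * v 0 k1 + u 0 k2 * v 0 k2.
Proof. exact: sum3E. Qed.

Lemma dotvC u v : dotv u v = dotv v u.
Proof. by rewrite !dotvE; ring. Qed.

Lemma dotvDl u v w : dotv (u + v) w = dotv u w + dotv v w.
Proof. by rewrite !dotvE !mxE; ring. Qed.

Lemma dotvZl a u v : dotv (a *: u) v = a * dotv u v.
Proof. by rewrite !dotvE !mxE; ring. Qed.

Lemma dotvNl u v : dotv (- u) v = - dotv u v.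
Proof. by rewrite !dotvE !mxE; ring. Qed.

Lemma dotvDr u v w : dotv w (u + v) = dotv w u + dotv w v.
Proof. by rewrite ![dotv w _]dotvC dotvDl. Qed.

Lemma dotvZr a u v : dotv u (a *: v) = a * dotv u v.
Proof. by rewrite ![dotv u _]dotvC dotvZl. Qed.

Lemma dotvNr u v : dotv u (- v) = - dotv u v.
Proof. by rewrite ![dotv u _]dotvC dotvNl. Qed.

Definition dotv_lin := (dotvDl, dotvDr, dotvZl, dotvZr, dotvNl, dotvNr).

Lemma dot_crossl u v : dotv u (cross u v) = 0.
Proof. by rewrite dotvE !vec3E; ring. Qed.

Lemma dot_crossr u v : dotv v (cross u v) = 0.
Proof. by rewrite dotvE !vec3E; ring. Qed.

Lemma dot_cross_cross u v w : dotv (cross u v) (cross u w) =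
  dotv u u * dotv v w - dotv u v * dotv u w.
Proof. by rewrite !dotvE !vec3E; ring. Qed.

Lemma dot_cross_rotate u v w : dotv u (cross v w) = dotv v (cross w u).
Proof. by rewrite !dotvE !vec3E; ring. Qed.

Lemma dot_crossC u v w : dotv u (cross v w) = - dotv u (cross w v).
Proof. by rewrite !dotvE !vec3E; ring. Qed.

(** Only the components orthogonal to [N] move, and their inner product is multiplied by
    [x ^ 2 + y ^ 2]. *)
Lemma dotv_rot N x y v w : dotv N N = 1 -> x ^+ 2 + y ^+ 2 = 1 ->
  dotv (axrot N x y v) (axrot N x y w) = dotv v w.
Proof.
move=> NN xy; rewrite /axrot !dotv_lin NN.
rewrite ![dotv N (cross _ _)]dot_crossl ![dotv (cross _ _) N]dotvC.
rewrite ![dotv N (cross _ _)]dot_crossl dot_cross_cross NN.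
rewrite [dotv (cross N v) w]dotvC (dot_crossC w N v) (dot_cross_rotate w v N).
rewrite ![dotv N v]dotvC ![dotv N w]dotvC.
transitivity (dotv v N * dotv w N
   + (x ^+ 2 + y ^+ 2) * (dotv v w - dotv v N * dotv w N)); first by ring.
by rewrite xy; ring.
Qed.

Lemma dotv_rotl N x y v w : dotv (axrot N x y v) w =
  dotv v N * dotv N w + x * (dotv v w - dotv v N * dotv N w)
  + y * dotv w (cross N v).
Proof. by rewrite /axrot !dotv_lin [dotv (cross _ _) _]dotvC. Qed.

Lemma rot_axis N x y : dotv N N = 1 -> axrot N x y N = N.
Proof.
move=> NN; rewrite /axrot NN scale1r subrr scaler0 addr0.
suff -> : cross N N = 0 by rewrite scaler0 addr0.
by apply/rowP; elim/I3P; rewrite !vec3E !mxE; ring.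
Qed.

Lemma rot1 N v : axrot N 1 0 v = v.
Proof. by rewrite /axrot scale1r scale0r addr0 addrC subrK. Qed.

Lemma dotv_mul (g : 'M[R]_3) u v : g *m g^T = 1%:M ->
  dotv (u *m g) (v *m g) = dotv u v.
Proof.
move=> gg.
have E p q : (p *m q^T) 0 0 = dotv p q.
  by rewrite mxE; apply: eq_bigr => k _; rewrite mxE.
by rewrite -!E trmx_mul mulmxA -(mulmxA u) gg mulmx1.
Qed.

(** By Lagrange's identity, [1 - (dotv u v) ^ 2] is the squared length of [cross u v]. *)
Lemma dotv_sqr_bound u v : dotv u u = 1 -> dotv v v = 1 -> -1 <= dotv u v <= 1.
Proof.
move=> uu vv; have := dot_cross_cross u v v; rewrite uu vv.
have : 0 <= dotv (cross u v) (cross u v) by rewrite dotvE !addr_ge0// -expr2 sqr_ge0.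
by move=> ? ?; apply/andP; split; nra.
Qed.

End Vectors.

(** * Deformation of a nonplanar polygon *)

Section SmoothVectors.
Variables (R : realType) (e : R).

Definition Cv k (v : R -> 'rV[R]_3) := forall c, Ck e k (fun t => v t 0 c).

Lemma CkB k (f g : R -> R) : Ck e k f -> Ck e k g -> Ck e k (fun t => f t - g t).
Proof. by move=> Cf Cg; apply: CkD => //; exact: CkN. Qed.

Lemma Ck_dotv k (u v : R -> 'rV[R]_3) : Cv k u -> Cv k v ->
  Ck e k (fun t => dotv (u t) (v t)).
Proof.
move=> Cu Cv'.
apply: (@eq_Ck _ _ _ (fun t => u t 0 k0 * v t 0 k0 + u t 0 k1 * v t 0 k1
  + u t 0 k2 * v t 0 k2)); first by move=> t _; rewrite dotvE.
by apply: CkD; [apply: CkD|]; apply: CkM.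
Qed.

Lemma Cv_cross k (u v : R -> 'rV[R]_3) : Cv k u -> Cv k v ->
  Cv k (fun t => cross (u t) (v t)).
Proof.
move=> Cu Cv'; elim/I3P; (apply: eq_Ck; first by move=> t _; rewrite vec3E);
  by apply: CkB; apply: CkM.
Qed.

Lemma Cv_rot k (N v : R -> 'rV[R]_3) (x y : R -> R) :
  Cv k N -> Cv k v -> Ck e k x -> Ck e k y ->
  Cv k (fun t => axrot (N t) (x t) (y t) (v t)).
Proof.
move=> CN Cv' Cx Cy c.
apply: (@eq_Ck _ _ _ (fun t => dotv (v t) (N t) * N t 0 c
  + x t * (v t 0 c - dotv (v t) (N t) * N t 0 c)
  + y t * cross (N t) (v t) 0 c)).
  by move=> t _; rewrite /axrot !mxE.
have CNv : Ck e k (fun t => dotv (v t) (N t) * N t 0 c).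
  by apply: CkM => //; exact: Ck_dotv.
apply: CkD; last by apply: CkM => //; exact: Cv_cross.
by apply: CkD => //; apply: CkM => //; apply: CkB.
Qed.

End SmoothVectors.

Section Chain.
Variables (R : realType) (n : nat) (u : nat -> 'rV[R]_3) (a : R).
Hypothesis uu : forall i, dotv (u i) (u i) = 1.
Hypothesis ua : forall i, (i < n)%N -> dotv (u i) (u i.+1) = cos a.
Hypothesis a_pi : 0 < a < pi.

Let sa_gt0 : 0 < sin a. Proof. exact: sin_gt0_pi. Qed.

(** The cross product has length [sin a], so this is the unit axis of the edge from [u i] to
    [u i.+1]. *)
Definition hinge i : 'rV[R]_3 := (sin a)^-1 *: cross (u i) (u i.+1).

(** The rotations about the original hinges [i - 1], ..., [0] are applied in this order, so each
    edge opens while everything after it is carried along rigidly. *)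
Fixpoint opening (t : R) i (v : 'rV[R]_3) : 'rV[R]_3 :=
  if i is i'.+1 then opening t i' (axrot (hinge i') (cos t) (sin t) v) else v.

Definition chain t i := opening t i (u i).

Lemma hinge_unit i : (i < n)%N -> dotv (hinge i) (hinge i) = 1.
Proof.
move=> ltin; rewrite /hinge !dotv_lin dot_cross_cross !uu ua// mulr1 -expr2.
by rewrite -sin2cos2 expr2 mulrA -invfM -expr2 mulVf// expf_neq0// gt_eqF.
Qed.

Lemma dotv_opening t i v w : (i <= n)%N ->
  dotv (opening t i v) (opening t i w) = dotv v w.
Proof.
elim: i v w => //= i IH v w ltin.
by rewrite IH ?(ltnW ltin)// dotv_rot ?hinge_unit// cos2Dsin2.
Qed.

Lemma chain_unit t i : (i <= n)%N -> dotv (chain t i) (chain t i) = 1.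
Proof. by move=> lein; rewrite dotv_opening. Qed.

(** The isometry [opening t i] is common to both ends. What remains is one rotation about [hinge i],
    moving [u i.+1] away from [u i] along their great circle. *)
Lemma chain_edge t i : (i < n)%N ->
  dotv (chain t i) (chain t i.+1) = cos (a + t).
Proof.
move=> ltin; rewrite /chain /= dotv_opening ?(ltnW ltin)//.
rewrite dotvC dotv_rotl cosD.
have uh : dotv (hinge i) (u i) = 0.
  by rewrite /hinge dotv_lin dotvC dot_crossl mulr0.
rewrite uh !mulr0 subr0 add0r (dotvC (u i.+1)) ua//.
suff -> : dotv (u i) (cross (hinge i) (u i.+1)) = - sin a by ring.
rewrite dot_cross_rotate dot_crossC /hinge dotv_lin dot_cross_cross !uu ua//.
rewrite mul1r -expr2 -sin2cos2 expr2 mulKf// gt_eqF//.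
Qed.

Lemma chain_end t : chain t 0 = u 0%N. Proof. by []. Qed.

Lemma chain0 i : chain 0 i = u i.
Proof.
rewrite /chain; elim: i (u i) => //= i IH v.
by rewrite cos0 sin0 rot1 IH.
Qed.

Lemma Cv_opening e k i (v : R -> 'rV[R]_3) :
  Cv e k v -> Cv e k (fun t => opening t i (v t)).
Proof.
elim: i v => //= i IH v Cv'; apply: (IH (fun t => axrot _ _ _ (v t))).
have [? ?] := Ck_cos_sin e k.
by apply: Cv_rot => // c; exact: Ck_cst.
Qed.

Lemma Cv_chain e k i : Cv e k (fun t => chain t i).
Proof. by apply: (@Cv_opening e k i (fun=> u i)) => c; exact: Ck_cst. Qed.

Lemma near_continuous_gt0 (f : R -> R) : (forall e k, Ck e k f) -> 0 < f 0 ->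
  \forall t \near (0 : R), 0 < f t.
Proof.
move=> Cf f0; have [g df _] := Cf 1 1%N.
have f0c : {for (0 : R), continuous f}.
  apply/differentiable_continuous/derivable1_diffP.
  by case: (df 0 _); rewrite ?normr0.
exact: (cvgr_gt (f 0) f0c).
Qed.

Section Tail.
Variable j : nat.
Hypothesis jn : (j < n)%N.
Hypothesis un : dotv (u n) (u 0%N) = cos a.
Hypothesis uj : dotv (u 0%N) (cross (u j) (u n)) != 0.

(* [(cx t, cy t)] is the solution of [cB x + cC y = cD], [x ^ 2 + y ^ 2 = 1]
   with [(cx 0, cy 0) = (1, 0)]. *)
Let cA t := dotv (chain t n) (chain t j) * dotv (chain t j) (u 0%N).
Let cB t := dotv (chain t n) (u 0%N) - cA t.
Let cC t := dotv (u 0%N) (cross (chain t j) (chain t n)).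
Let cD t := cos (a + t) - cA t.
Let disc t := cB t ^+ 2 + cC t ^+ 2 - cD t ^+ 2.
Let sq t := Num.sg (cC 0) * Num.sqrt (disc t).
Let cx t := (cB t * cD t + cC t * sq t) / (cB t ^+ 2 + cC t ^+ 2).
Let cy t := (cC t * cD t - cB t * sq t) / (cB t ^+ 2 + cC t ^+ 2).

(** Turning the tail about [chain t j] changes no edge inside the chain and leaves one parameter for
    the closing edge. *)
Definition swing t i :=
  if (i <= j)%N then chain t i else axrot (chain t j) (cx t) (cy t) (chain t i).

Let cC0 : cC 0 != 0. Proof. by rewrite /cC !chain0. Qed.

Let BD0 : cB 0 = cD 0.
Proof. by rewrite /cB /cD chain0 un addr0. Qed.

Let disc0 : disc 0 = cC 0 ^+ 2. Proof. by rewrite /disc BD0; ring. Qed.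

(** The factor [Num.sg (cC 0)] selects the branch of the root that passes through [(1, 0)]. *)
Let sq0 : sq 0 = cC 0. Proof. by rewrite /sq disc0 sqrtr_sqr -numEsg. Qed.

Let xy0 : (cx 0 = 1) /\ (cy 0 = 0).
Proof.
rewrite /cx /cy sq0 -BD0.
have h : cB 0 ^+ 2 + cC 0 ^+ 2 != 0.
  by rewrite gt_eqF// ltr_wpDl ?sqr_ge0// exprn_even_gt0.
split; first by rewrite -!expr2 divff.
by rewrite [cC 0 * _]mulrC subrr mul0r.
Qed.

(** Up to the denominator [cB ^ 2 + cC ^ 2], the pair is [cD (cB, cC) + sq (cC, - cB)]. The second
    term is orthogonal to [(cB, cC)], so it does not affect the line equation; the length is 1
    because [cD ^ 2 + sq ^ 2 = cB ^ 2 + cC ^ 2]. *)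
Let xyP t : 0 < disc t -> cx t ^+ 2 + cy t ^+ 2 = 1 /\
  cA t + cx t * cB t + cy t * cC t = cos (a + t).
Proof.
move=> d0.
have h : cB t ^+ 2 + cC t ^+ 2 != 0.
  rewrite gt_eqF//; move: d0; rewrite /disc subr_gt0; apply: le_lt_trans.
  exact: sqr_ge0.
have s2 : sq t ^+ 2 = cB t ^+ 2 + cC t ^+ 2 - cD t ^+ 2.
  by rewrite /sq exprMn sqr_sg cC0 mul1r sqr_sqrtr// ltW.
split.
  rewrite /cx /cy !expr_div_n -mulrDl.
  transitivity ((cB t ^+ 2 + cC t ^+ 2) * (cD t ^+ 2 + sq t ^+ 2)
    / (cB t ^+ 2 + cC t ^+ 2) ^+ 2).
    by congr (_ / _); ring.
  by rewrite s2; field.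
suff : cx t * cB t + cy t * cC t = cD t by rewrite /cD => E; rewrite -addrA E; ring.
by rewrite /cx /cy; field.
Qed.

Let CA e k : Ck e k cA.
Proof.
apply: CkM; apply: Ck_dotv; try exact: Cv_chain.
by move=> c; exact: Ck_cst.
Qed.

Let CB e k : Ck e k cB.
Proof.
apply: CkB => //; apply: Ck_dotv; first exact: Cv_chain.
by move=> c; exact: Ck_cst.
Qed.

Let CC e k : Ck e k cC.
Proof.
apply: Ck_dotv; first by move=> c; exact: Ck_cst.
by apply: Cv_cross; exact: Cv_chain.
Qed.

Let CD e k : Ck e k cD.
Proof.
apply: CkB => //.
apply: (@eq_Ck _ _ _ (fun t => cos a * cos t - sin a * sin t)).
  by move=> t _; rewrite cosD.
have [? ?] := Ck_cos_sin e k.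
by apply: CkB; apply: CkM => //; exact: Ck_cst.
Qed.

Let CsumBC e k : Ck e k (fun t => cB t ^+ 2 + cC t ^+ 2).
Proof. by apply: CkD; apply: CkM. Qed.

Let Cdisc e k : Ck e k disc.
Proof. by apply: CkB => //; apply: CkM. Qed.

Lemma swingP : exists2 e : R, 0 < e & forall t, `|t| < e ->
  [/\ 0 < a + t < pi,
      forall i, (i <= n)%N -> dotv (swing t i) (swing t i) = 1,
      forall i, (i < n)%N -> dotv (swing t i) (swing t i.+1) = cos (a + t),
      dotv (swing t n) (swing t 0%N) = cos (a + t)
    & forall i k, Cv e k (fun t => swing t i)].
Proof.
have /nbhs_ballP[e1 e10 he1] : \forall t \near (0 : R), 0 < disc t.
  by apply: near_continuous_gt0 => //; rewrite disc0 exprn_even_gt0.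
have /andP[a0 api] := a_pi.
(* Within [e1] the discriminant stays positive; the other two bounds keep [a + t] in [(0, pi)]. *)
exists (Num.min e1 (Num.min a (pi - a))).
  by rewrite !lt_min a0 subr_gt0 api/= andbT.
move=> t te.
have dgt0 s : `|s| < Num.min e1 (Num.min a (pi - a)) -> 0 < disc s.
  rewrite !lt_min => /andP[se1 _]; apply: he1.
  by rewrite /ball /= sub0r normrN.
have dt := dgt0 _ te.
have [xy1 xyD] := xyP dt.
have lejn := ltnW jn.
split.
- move: te; rewrite !lt_min => /and3P[_ ta tp].
  have := ler_norm t; have := ler_norm (- t); rewrite normrN => ? ?.
  by apply/andP; split; lra.
- move=> i lein; rewrite /swing; case: ifP => _; first exact: chain_unit.
  by rewrite dotv_rot ?chain_unit.
- move=> i ltin; rewrite /swing; have [leij|ltij|Eij] := ltngtP i j.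
  + exact: chain_edge.
  + by rewrite dotv_rot ?chain_unit// chain_edge.
  (* The pivot [chain t j] is fixed by the rotation about itself, so both ends of this edge may be
     regarded as rotated. *)
  + rewrite Eij -{1}(@rot_axis _ (chain t j) (cx t) (cy t)) ?chain_unit//.
    by rewrite dotv_rot ?chain_unit// chain_edge.
- rewrite /swing /= chain_end; case: ifP => [lenj|_].
    by rewrite leqNgt jn in lenj.
  rewrite dotv_rotl -xyD; congr (_ + _).
- move=> i k; rewrite /swing; case: leqP => _; first exact: Cv_chain.
  have Csq : Ck (Num.min e1 (Num.min a (pi - a))) k sq.
    by apply: CkM; [exact: Ck_cst | exact: Ck_sqrt].
  have CV : Ck (Num.min e1 (Num.min a (pi - a))) k
      (fun t => (cB t ^+ 2 + cC t ^+ 2)^-1).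
    apply: CkV => // s /dgt0 ds; rewrite gt_eqF//.
    by move: ds; rewrite /disc subr_gt0; apply: le_lt_trans; exact: sqr_ge0.
  apply: Cv_rot; try exact: Cv_chain.
    by apply: CkM => //; apply: CkD; apply: CkM.
  by apply: CkM => //; apply: CkB; apply: CkM.
Qed.

Lemma swing0 i : swing 0 i = u i.
Proof.
rewrite /swing; case: ifP => _; rewrite ?chain0//.
by have [-> ->] := xy0; rewrite rot1.
Qed.

End Tail.
End Chain.

Local Open Scope quotient_scope.

(** * Polygons with vertices indexed by [nat]; planarity of critical points *)

Section Polygons.
Variables (R : realType) (n : nat).
Implicit Types (P Q : B R n.+1) (i j : nat) (a : R).

(* [inord n.+1 = 0], so [vert] closes the polygon up. *)
Definition vert (M : 'M[R]_(n.+1, 3)) i : 'rV[R]_3 := row (inord i) M.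

Definition polymx (w : nat -> 'rV[R]_3) : 'M[R]_(n.+1, 3) :=
  \matrix_(i, k) w i 0 k.

Lemma vert_polymx w i : (i <= n)%N -> vert (polymx w) i = w i.
Proof. by move=> lein; apply/rowP => k; rewrite !mxE inordK. Qed.

Lemma inord_closed : inord n.+1 = inord 0 :> 'I_n.+1.
Proof.
apply: val_inj; rewrite /= [RHS]inordK//.
by rewrite /inord /insubd insubF ?ltnn.
Qed.

Lemma vert_closed M : vert M n.+1 = vert M 0.
Proof. by rewrite /vert inord_closed. Qed.

Lemma ordS_inord i : (i <= n)%N -> ordS (inord i : 'I_n.+1) = inord i.+1.
Proof.
move=> lein; apply: val_inj; rewrite /= inordK//.
have [ltin|leni] := ltnP i n; first by rewrite modn_small// inordK.
have -> : i = n by apply/eqP; rewrite eqn_leq lein.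
by rewrite modnn inord_closed inordK.
Qed.

Lemma polymxK M : polymx (vert M) = M.
Proof. by apply/matrixP => i k; rewrite !mxE inord_val. Qed.

Lemma angle_dot (u v : 'rV[R]_3) a : dotv u u = 1 -> dotv v v = 1 ->
  0 < a < pi -> (sdist u v = a <-> dotv u v = cos a).
Proof.
move=> uu vv /andP[a0 api]; rewrite /sdist; split => [<-|->].
  by rewrite acosK// in_itv/= dotv_sqr_bound.
by rewrite cosK// in_itv/= !ltW.
Qed.

(** The case [i = n] of the last condition is the closing edge, by [vert_closed]. *)
Lemma BsetP M a : Bset (M, a) <->
  [/\ 0 < a < pi, forall i, dotv (vert M i) (vert M i) = 1
    & forall i, (i <= n)%N -> dotv (vert M i) (vert M i.+1) = cos a].
Proof.
split=> [[/= Mu api Me]|[api Mu Me]].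
  split=> // [i|i lein]; first exact: Mu.
  apply/angle_dot => //; try exact: Mu.
  by rewrite /vert -ordS_inord.
split=> //= i.
  by rewrite /sphere2/= -[i]inord_val; exact: Mu.
have ME : sdist (vert M i) (vert M i.+1) = a.
  by apply/angle_dot => //; apply: Me; rewrite -ltnS.
by move: ME; rewrite /vert -ordS_inord -1?ltnS// inord_val.
Qed.

Definition pts P := (val P).1.
Definition edge P := (val P).2.

Lemma BP P : Bset (pts P, edge P).
Proof. by have := set_valP P; rewrite /pts /edge; case: (set_val P). Qed.

Lemma edge_bound P : 0 < edge P < pi.
Proof. by have /BsetP[] := BP P. Qed.

Lemma pts_unit P i : dotv (vert (pts P) i) (vert (pts P) i) = 1.
Proof. by have /BsetP[] := BP P. Qed.

Lemma pts_edge P i : (i <= n)%N ->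
  dotv (vert (pts P) i) (vert (pts P) i.+1) = cos (edge P).
Proof. by have /BsetP[_ _] := BP P; apply. Qed.

Lemma pi_eqP P Q : \pi_(X R n.+1) P = \pi_(X R n.+1) Q <->
  exists2 g : 'M[R]_3, SO3 g & pts Q = pts P *m g^T /\ edge Q = edge P.
Proof.
split=> [/eqmodP/asboolP //|h]; apply/eqmodP; exact/asboolP.
Qed.

(** Since [0 < edge P < pi], vertices [0] and [n] are linearly independent; the vanishing
    determinants put every vertex on the great circle through them. *)
Definition planar P := forall j, (j <= n)%N ->
  dotv (vert (pts P) 0) (cross (vert (pts P) j) (vert (pts P) n)) = 0.

Lemma critical_planar P : critical_point (@mu R n.+1) (\pi_(X R n.+1) P) ->
  planar P.
Proof.
move=> crit j lejn; apply: contrapT => /eqP ndet.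
have ltjn : (j < n)%N.
  rewrite ltn_neqAle lejn andbT; apply: contra ndet => /eqP ->.
  by rewrite dot_cross_rotate dot_crossl.
have un0 : dotv (vert (pts P) n) (vert (pts P) 0) = cos (edge P).
  by rewrite -vert_closed pts_edge.
have ue i : (i < n)%N ->
    dotv (vert (pts P) i) (vert (pts P) i.+1) = cos (edge P).
  by move=> /ltnW; exact: pts_edge.
have [e e0 sw] := swingP (pts_unit P) ue (edge_bound P) ltjn un0 ndet.
pose S t i := swing n (vert (pts P)) (edge P) j t i.
pose q t : 'M[R]_(n.+1, 3) * R := (polymx (S t), edge P + t).
have qB t : `|t| < e -> q t \in (@Bset R n.+1).
  move=> /sw[api uu ee en _]; apply/mem_set/BsetP; split=> // [i|i lein].
    have -> : vert (polymx (S t)) i = S t (inord i : 'I_n.+1).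
      by apply/rowP => k; rewrite !mxE.
    by apply: uu; rewrite -ltnS.
  rewrite vert_polymx//; have [ltin|leni] := ltnP i n.
    by rewrite vert_polymx// ee.
  have -> : i = n by apply/eqP; rewrite eqn_leq lein.
  by rewrite vert_closed vert_polymx.
(* A curve has to be total: where [q t] fails to be a polygon, which only happens outside [|t| < e],
   [insubd] returns [P]. *)
pose b t : B R n.+1 := insubd P (q t).
have bE t : `|t| < e -> val (b t) = q t.
  by move=> te; rewrite /b val_insubd qB.
have b0 : b 0 = P.
  apply: val_inj; rewrite bE ?normr0// /q addr0 [RHS]surjective_pairing.
  congr (_, _); rewrite -[RHS]polymxK; apply/matrixP => i k; rewrite !mxE.
  by rewrite /S swing0// !mxE.
have e00 : `|0 : R| < e by rewrite normr0.
have [_ _ _ _ CS] := sw 0 e00.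
have Cb : smooth_curve_B e b.
  split=> [i k|]; apply: smooth_onP => d.
    apply: (@eq_Ck _ _ _ (fun t => S t i 0 k)); last exact: CS.
    by move=> t te; rewrite bE// mxE.
  apply: (@eq_Ck _ _ _ (fun t => edge P + t)); first by move=> t te; rewrite bE.
  by apply: CkD; [exact: Ck_cst | exact: Ck_id].
have Dmu : is_derive (0 : R) 1 (@mu R n.+1 \o (fun t => \pi_(X R n.+1) (b t))) 0.
  by apply: crit; [exists e, b | rewrite b0].
have : is_derive (0 : R) 1 (@mu R n.+1 \o (fun t => \pi_(X R n.+1) (b t))) 1.
  apply: (@near_eq_is_derive _ _ _ (fun t => edge P + t)).
    by apply: filterS (near_norm_lt e00) => t te /=; rewrite mu_pi bE.
  have := is_deriveD (is_derive_cst (edge P) (0 : R) 1) (is_derive_id (0 : R) 1).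
  by rewrite add0r.
move=> [_ D1]; move: Dmu => [_]; rewrite D1 => /eqP.
by rewrite oner_eq0.
Qed.

End Polygons.

(** * Planar polygons *)

Section Planar.
Variables (R : realType) (n : nat).
Implicit Types (P Q : B R n.+1) (i j : nat) (a : R) (A : {set 'I_n.+1}).

Definition sgn A i : R := if (inord i : 'I_n.+1) \in A then 1 else -1.

Definition turns A i : R := \sum_(l < i) sgn A l.

(** A path on the equator from [vec3 1 0 0]; step [i] turns by [a] if [i \in A] and by [- a]
    otherwise. *)
Definition cpt a A i : 'rV[R]_3 :=
  vec3 (cos (a * turns A i)) (sin (a * turns A i)) 0.

Lemma sgn_sqr A i : sgn A i * sgn A i = 1.
Proof. by rewrite /sgn; case: ifP; rewrite ?mulr1// mulrNN mulr1. Qed.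

Lemma turnsS A i : turns A i.+1 = turns A i + sgn A i.
Proof. by rewrite /turns big_ord_recr. Qed.

Lemma turns0 A : turns A 0 = 0.
Proof. exact: big_ord0. Qed.

Lemma turns_full A : turns A n.+1 = #|A|.*2%:R - n.+1%:R.
Proof.
rewrite /turns (eq_bigr (fun l => (l \in A)%:R *+ 2 - 1)); last first.
  by move=> l _; rewrite /sgn inord_val; case: ifP => _; rewrite ?mul0rn ?sub0r// mulr2n addrK.
rewrite sumrB sumr_const card_ord sumrMnl -natr_sum -mulrnA muln2.
by rewrite -[#|A|]sum1_card [X in _ = X.*2%:R - _]big_mkcond.
Qed.

Lemma cos_sin_sgn a A i : cos (a * sgn A i) = cos a /\
  sin (a * sgn A i) = sgn A i * sin a.
Proof.
rewrite /sgn; case: ifP => _; first by rewrite mulr1 mul1r.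
by rewrite mulrN1 cosN sinN mulN1r.
Qed.

Lemma cptS a A i : cpt a A i.+1 =
  vec3 (cos (a * turns A i) * cos a - sin (a * turns A i) * (sgn A i * sin a))
       (sin (a * turns A i) * cos a + cos (a * turns A i) * (sgn A i * sin a)) 0.
Proof.
by rewrite /cpt turnsS mulrDr cosD sinD; have [-> ->] := cos_sin_sgn a A i.
Qed.

Lemma cpt0 a A : cpt a A 0 = vec3 1 0 0.
Proof. by rewrite /cpt turns0 mulr0 cos0 sin0. Qed.

Lemma dotv_cpt a A i j :
  dotv (cpt a A i) (cpt a A j) = cos (a * (turns A j - turns A i)).
Proof. by rewrite dotvE !vec3E mulrBr cosB; ring. Qed.

Lemma cpt_closed a A : cos (a * turns A n.+1) = 1 -> cpt a A n.+1 = cpt a A 0.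
Proof.
move=> c1; rewrite cpt0 /cpt c1; congr vec3.
by apply: cos1sin0; rewrite c1 normr1.
Qed.

Lemma vert_cpt a A i : cos (a * turns A n.+1) = 1 -> (i <= n.+1)%N ->
  vert (polymx n (cpt a A)) i = cpt a A i.
Proof.
move=> c1; rewrite leq_eqVlt => /orP[/eqP ->|ltin]; last exact: vert_polymx.
by rewrite vert_closed vert_polymx// cpt_closed.
Qed.

Lemma cpt_Bset a A : 0 < a < pi -> cos (a * turns A n.+1) = 1 ->
  Bset (polymx n (cpt a A), a).
Proof.
move=> api c1; apply/BsetP; split=> // [i|i lein].
  have -> : vert (polymx n (cpt a A)) i = cpt a A (inord i : 'I_n.+1).
    by apply/rowP => k; rewrite !mxE.
  by rewrite dotv_cpt subrr mulr0 cos0.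
rewrite !vert_cpt//; last exact: ltnW.
rewrite dotv_cpt turnsS addrAC subrr add0r.
by have [-> _] := cos_sin_sgn a A i.
Qed.

Lemma is_derive_uniq (f : R -> R) (t d d' : R) :
  is_derive t 1 f d -> is_derive t 1 f d' -> d = d'.
Proof. by move=> [_ <-] [_ <-]. Qed.

Lemma cpt_critical P A : cos (edge P * turns A n.+1) = 1 ->
  turns A n.+1 != 0 -> pts P = polymx n (cpt (edge P) A) ->
  critical_point (@mu R n.+1) (\pi_(X R n.+1) P).
Proof.
move=> c1 T0 PE c [e [b [e0 [Cb Ca] cE]]] c0.
have e00 : `|0 : R| < e by rewrite normr0.
have /pi_eqP[g [gg dg] [bP eP]] : \pi_(X R n.+1) P = \pi_(X R n.+1) (b 0).
  by rewrite -cE.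
(* The lift is rotated back by [g], so that at time 0 it is the equatorial polygon itself and its
   third coordinates vanish there. *)
pose z t i : 'rV[R]_3 := vert (pts (b t)) i *m g.
pose D i k : R := 'D_1 (fun t => z t i 0 k) 0.
pose a' : R := 'D_1 (fun t => edge (b t)) 0.
have Da : is_derive (0 : R) 1 (fun t => edge (b t)) a'.
  by apply: derivableP; exact: (Ca 0%N).
have Dz i k : is_derive (0 : R) 1 (fun t => z t i 0 k) (D i k).
  apply: derivableP.
  rewrite [X in derivable X](_ : _ = \sum_l (fun t => pts (b t) (inord i) l * g l k)).
    apply: derivable_sum => l; apply: derivableM; last exact: derivable_cst.
    exact: (Cb _ _ 0%N).
  by apply/funext => t; rewrite fct_sumE mxE; apply: eq_bigr => l _; rewrite !mxE.
have z0 i : (i <= n.+1)%N -> z 0 i = cpt (edge P) A i.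
  move=> lein; rewrite -vert_cpt// -PE /z /vert -row_mul bP -mulmxA.
  by rewrite (mulmx1C gg) mulmx1.
have zz t i : dotv (z t i) (z t i) = 1 by rewrite dotv_mul// pts_unit.
have ze t i : (i <= n)%N -> dotv (z t i) (z t i.+1) = cos (edge (b t)).
  by move=> lein; rewrite dotv_mul// pts_edge.
have Ddot i j : is_derive (0 : R) 1 (fun t => dotv (z t i) (z t j))
  (z 0 i 0 k0 * D j k0 + z 0 j 0 k0 * D i k0 +
   (z 0 i 0 k1 * D j k1 + z 0 j 0 k1 * D i k1) +
   (z 0 i 0 k2 * D j k2 + z 0 j 0 k2 * D i k2)).
  rewrite [X in is_derive _ _ X](_ : _ = fun t => z t i 0 k0 * z t j 0 k0 +
    z t i 0 k1 * z t j 0 k1 + z t i 0 k2 * z t j 0 k2); last first.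
    by apply/funext => t; rewrite dotvE.
  by apply: is_deriveD; [apply: is_deriveD|]; apply: is_deriveM.
have E1 i : (i <= n.+1)%N -> z 0 i 0 k0 * D i k0 + z 0 i 0 k1 * D i k1 = 0.
  move=> lein; have h := Ddot i i.
  have : is_derive (0 : R) 1 (fun t => dotv (z t i) (z t i)) 0.
    rewrite (_ : (fun _ => _) = cst 1); last by apply/funext => t; rewrite zz.
    exact: is_derive_cst.
  move=> /(is_derive_uniq h); rewrite z0// !vec3E => h'.
  by lra.
have E2 i : (i <= n)%N -> z 0 i 0 k0 * D i.+1 k0 + z 0 i.+1 0 k0 * D i k0 +
   (z 0 i 0 k1 * D i.+1 k1 + z 0 i.+1 0 k1 * D i k1) = - sin (edge P) * a'.
  move=> lein; have h := Ddot i i.+1.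
  have : is_derive (0 : R) 1 (fun t => dotv (z t i) (z t i.+1)) (- sin (edge P) * a').
    rewrite (_ : (fun _ => _) = cos \o (fun t => edge (b t))); last first.
      by apply/funext => t; rewrite ze.
    by apply: is_derive1_comp; rewrite eP; exact: is_derive_cos.
  move=> /(is_derive_uniq h) <-; have lein' := leqW lein; rewrite !z0// !vec3E.
  by lra.
(* The velocity of vertex [i] along the equator. *)
pose w i := z 0 i 0 k0 * D i k1 - z 0 i 0 k1 * D i k0.
have sa : sin (edge P) != 0 by rewrite gt_eqF// sin_gt0_pi// edge_bound.
have wS i : (i <= n)%N -> w i.+1 = w i + sgn A i * a'.
  (* Both sides are multiplied by [sgn A i * sin (edge P)], the factor that arises from the
     differentiated edge equation [E2]. *)
  move=> lein; have lein' := leqW lein.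
  apply: (mulfI sa); apply: (mulfI (_ : sgn A i != 0)).
    by rewrite /sgn; case: ifP => _; rewrite ?oppr_eq0 oner_eq0.
  have := E1 i.+1 lein; have := E2 i lein; have := E1 i lein'.
  rewrite /w !z0// cptS !vec3E.
  set C := cos (edge P * _); set S := sin (edge P * _).
  set ca := cos (edge P); set si := sin (edge P).
  move=> h1 h2 h3.
  (* By [E1] the velocities have no radial part, so the inner products of each vertex with the
     velocity of its neighbour are multiples of [w i.+1] ([K1]) and [w i] ([K2]). *)
  have K1 : C * D i.+1 k0 + S * D i.+1 k1 =
      - (sgn A i * si * ((C * ca - S * (sgn A i * si)) * D i.+1 k1
                        - (S * ca + C * (sgn A i * si)) * D i.+1 k0)).
    have := congr1 ( *%R ca) h3; rewrite mulr0 => h3'.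
    have c2 : ca ^+ 2 + sgn A i * sgn A i * si ^+ 2 = 1.
      by rewrite sgn_sqr mul1r cos2Dsin2.
    rewrite -[LHS]mul1r -c2 -[RHS]addr0 -h3'; ring.
  have K2 : (C * ca - S * (sgn A i * si)) * D i k0 + (S * ca + C * (sgn A i * si)) * D i k1
     = sgn A i * si * (C * D i k1 - S * D i k0).
    have := congr1 ( *%R ca) h1; rewrite mulr0 => h1'.
    rewrite -[RHS]addr0 -h1'; ring.
  have K3 : sgn A i * (si * (sgn A i * a')) = si * a'.
    by rewrite !mulrA [sgn A i * si]mulrC -(mulrA si) sgn_sqr mulr1.
  rewrite !mulrDr K3; lra.
have wE i : (i <= n.+1)%N -> w i = w 0%N + turns A i * a'.
  elim: i => [|i IH] lein; first by rewrite turns0 mul0r addr0.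
  by rewrite wS// IH ?(ltnW lein)// turnsS mulrDl addrA.
(* Vertices [n.+1] and [0] coincide at all times, so the total increment [turns A n.+1 * a']
   vanishes. *)
have : w n.+1 = w 0%N.
  have zC t : z t n.+1 = z t 0%N by rewrite /z vert_closed.
  have DC k : D n.+1 k = D 0%N k.
    by rewrite /D; under eq_fun do rewrite zC.
  by rewrite /w !DC !zC.
rewrite wE// => /eqP; rewrite -subr_eq0 addrAC subrr add0r mulf_eq0 (negPf T0) /=.
move=> /eqP a'0; apply: (@near_eq_is_derive _ _ _ (fun t => edge (b t))); last by rewrite a'0 in Da.
by apply: filterS (near_norm_lt e00) => t te /=; rewrite cE// mu_pi.
Qed.

End Planar.

(** * Normal form of planar polygons up to rotation *)

Section Frames.
Variable R : realType.
Implicit Types p e N u : 'rV[R]_3.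

Definition frame p e N : 'M[R]_3 := \matrix_(k, l) (nth p [:: p; e; N] k) 0 l.

Lemma frame_SO3 p e : dotv p p = 1 -> dotv e e = 1 -> dotv p e = 0 ->
  SO3 (frame p e (cross p e)).
Proof.
move=> pp ee pe.
have NN : dotv (cross p e) (cross p e) = 1.
  by rewrite dot_cross_cross pp ee pe mulr0 subr0 mulr1.
have [pN eN] := (dot_crossl p e, dot_crossr p e).
split.
  apply/matrixP => k l; rewrite !mxE; under eq_bigr do rewrite !mxE.
  rewrite -/(dotv _ _); move: k l.
  by elim/I3P => /=; elim/I3P => /=; rewrite // dotvC.
(* The cofactors of the third row are the coordinates of [cross p e], so the determinant is its
   squared length. *)
rewrite (expand_det_row _ k2) sum3E /cofactor !mxE /=.
have det2 (M : 'M[R]_2) : \det M = M 0 0 * M 1 1 - M 0 1 * M 1 0.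
  rewrite (expand_det_row _ 0) !big_ord_recl big_ord0 addr0 /cofactor !det_mx11 !mxE /=.
  rewrite addn0 expr0 mul1r addn1 expr1 mulN1r mulrN.
  by congr (_ * M _ _ - M _ _ * M _ _); apply: val_inj.
rewrite !det2 !mxE /= -[RHS]NN dotvE !vec3E /=.
have L : ((lift k0 0 = k1) * (lift k0 1 = k2) * (lift k1 0 = k0) *
    (lift k1 1 = k2) * (lift k2 0 = k0) * (lift k2 1 = k1))%type.
  by do !split; exact: val_inj.
by rewrite !L; ring.
Qed.

Lemma mul_frame p e N u :
  u *m (frame p e N)^T = vec3 (dotv u p) (dotv u e) (dotv u N).
Proof.
apply/rowP => c; rewrite !mxE; move: c.
by elim/I3P => /=; apply: eq_bigr => l _; rewrite !mxE.
Qed.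

End Frames.

Section Planar.
Variables (R : realType) (n : nat).
Implicit Types (P Q : B R n.+1) (i j : nat) (a : R) (A : {set 'I_n.+1}).

Lemma turnsC A i : turns R (~: A) i = - turns R A i.
Proof.
rewrite /turns -sumrN; apply: eq_bigr => l _; rewrite /sgn inE.
by case: (_ \in A); rewrite /= ?opprK.
Qed.

(** The half turn about the first axis fixes the starting vertex and reverses the equator. *)
Lemma cpt_flip a A : exists2 g : 'M[R]_3, SO3 g &
  polymx n (cpt a (~: A)) = polymx n (cpt a A) *m g^T.
Proof.
exists (diag_mx (vec3 1 (-1) (-1))).
  split; last first.
    by rewrite det_diag !big_ord_recl big_ord0 !mxE /= !mulr1 mul1r mulrNN mulr1.
  rewrite tr_diag_mx mul_mx_diag; apply/matrixP => k l; rewrite !mxE.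
  have [->|_] := eqVneq k l; last by rewrite mulr0n mul0r.
  by move: l; elim/I3P; rewrite /= ?mulr1 ?mulrNN ?mulr1.
rewrite tr_diag_mx mul_mx_diag; apply/matrixP => k l; rewrite !mxE turnsC mulrN.
rewrite cosN sinN; move: l; elim/I3P => /=; rewrite ?mulr1 ?mulrN1 ?oppr0//.
Qed.

(** The planar determinant [D i] of consecutive vertices has square [1 - cos a ^ 2], so it is
    [sin a] up to sign, and [A] collects the positive signs. Together with the inner product it
    determines the next vertex. *)
Lemma flat_cpt (M : 'M[R]_(n.+1, 3)) a : Bset (M, a) ->
  vert M 0 = vec3 1 0 0 -> (forall i, vert M i 0 k2 = 0) ->
  exists A, forall i, (i <= n.+1)%N -> vert M i = cpt a A i.
Proof.
move=> /BsetP[api uu ee] M0 Mz.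
pose D i := vert M i 0 k0 * vert M i.+1 0 k1 - vert M i 0 k1 * vert M i.+1 0 k0.
have sa : 0 < sin a by exact: sin_gt0_pi.
pose A := finset (fun i : 'I_n.+1 => 0 < D i); exists A => i.
have DE l : (l <= n)%N -> D l = sgn R A l * sin a.
  move=> leln; have : D l ^+ 2 = sin a ^+ 2.
    rewrite sin2cos2 -(ee l leln).
    have := uu l; have := uu l.+1; rewrite !dotvE !Mz !mulr0 !addr0 /D => h1 h2.
    set x := vert M l 0 k0 in h2 *; set y := vert M l 0 k1 in h2 *.
    set x' := vert M l.+1 0 k0 in h1 *; set y' := vert M l.+1 0 k1 in h1 *.
    transitivity ((x * x + y * y) * (x' * x' + y' * y') - (x * x' + y * y') ^+ 2).
      by ring.
    by rewrite h1 h2 mulr1.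
  move=> /eqP; rewrite eqf_sqr /sgn inE inordK ?ltnS//.
  case/orP => /eqP ->; first by rewrite sa mul1r.
  by rewrite oppr_gt0 ltNge (ltW sa) /= mulN1r.
elim: i => [|i IH] lein; first by rewrite M0 cpt0.
rewrite cptS -DE//; have IHi := IH (ltnW lein).
have [<- <-] : vert M i 0 k0 = cos (a * turns R A i) /\
  vert M i 0 k1 = sin (a * turns R A i).
  by rewrite IHi !vec3E.
have := uu i; rewrite -(ee i lein) /D !dotvE !Mz !mulr0 !addr0 => h.
apply/rowP; elim/I3P; rewrite !vec3E ?Mz// -[LHS]mul1r -h; ring.
Qed.

(** In the frame made of vertex [0], the normalized part of vertex [n] orthogonal to it, and their
    cross product, the polygon starts at [vec3 1 0 0] and planarity kills the third coordinates. *)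
Lemma planar_cpt P : planar P -> exists A, exists2 g : 'M[R]_3, SO3 g &
  polymx n (cpt (edge P) A) = pts P *m g^T /\ cos (edge P * turns R A n.+1) = 1.
Proof.
move=> pl; have api := edge_bound P.
have sa : sin (edge P) != 0 by rewrite gt_eqF// sin_gt0_pi.
pose p := vert (pts P) 0; pose q := vert (pts P) n.
pose e := (sin (edge P))^-1 *: (q - cos (edge P) *: p).
have pp : dotv p p = 1 := pts_unit P 0.
have qq : dotv q q = 1 := pts_unit P n.
have pq : dotv p q = cos (edge P).
  by rewrite /p -vert_closed dotvC pts_edge.
have ee : dotv e e = 1.
  rewrite /e !dotv_lin pp qq (dotvC q p) pq.
  transitivity ((sin (edge P))^-1 * (sin (edge P))^-1 * (1 - cos (edge P) ^+ 2)).
    by ring.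
  by rewrite -sin2cos2 expr2; field.
have pe : dotv p e = 0 by rewrite /e !dotv_lin pp pq mulr1 subrr mulr0.
have Sg := frame_SO3 pp ee pe; have [gg _] := Sg.
set g := frame p e (cross p e) in Sg gg.
have vM i : vert (pts P *m g^T) i = vert (pts P) i *m g^T by exact: row_mul.
have MB : Bset (pts P *m g^T, edge P).
  apply/BsetP; split=> // [i|i lein]; rewrite !vM dotv_mul ?pts_unit ?pts_edge//;
  by rewrite trmxK (mulmx1C gg).
have [] := flat_cpt MB.
- by rewrite vM mul_frame -/p pp pe dot_crossl.
- move=> i; have -> : vert (pts P *m g^T) i = vert (pts P *m g^T) (inord i : 'I_n.+1).
    by rewrite /vert inord_val.
  rewrite vM mul_frame vec3E /e.
  have -> : cross p ((sin (edge P))^-1 *: (q - cos (edge P) *: p)) =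
    (sin (edge P))^-1 *: cross p q.
    by apply/rowP; elim/I3P; rewrite !mxE /=; ring.
  rewrite dotv_lin dot_cross_rotate dot_crossC pl ?oppr0 ?mulr0//.
  by rewrite -ltnS.
- move=> A MA; exists A, g => //.
  have PA : polymx n (cpt (edge P) A) = pts P *m g^T.
    rewrite -[RHS]polymxK; apply/matrixP => i k; rewrite mxE [RHS]mxE.
    by rewrite MA// ltnW.
  split=> //; have := MA n.+1 (leqnn _); rewrite vert_closed MA// cpt0.
  by move=> /(congr1 (fun u : 'rV[R]_3 => u 0 k0)); rewrite !vec3E.
Qed.

(** The number [n.+1] of steps is odd, so [A] or its complement has a majority, and [cpt_flip]
    exchanges the two. *)
Lemma planar_cpt_maj P : ~~ odd n -> planar P -> exists A,
  [/\ (n.+1 < #|A|.*2)%N, cos (edge P * turns R A n.+1) = 1 &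
  exists2 g : 'M[R]_3, SO3 g & polymx n (cpt (edge P) A) = pts P *m g^T].
Proof.
move=> on /planar_cpt[A [g Sg [PA c1]]].
have [ltA|leA] := ltnP n.+1 #|A|.*2; first by exists A; split=> //; exists g.
exists (~: A); split.
- by have := cardsC A; rewrite card_ord; lia.
- by rewrite turnsC mulrN cosN.
- have [h Sh hE] := cpt_flip (edge P) A; exists (h *m g); first exact: SO3_mul.
  by rewrite hE PA trmx_mul mulmxA.
Qed.

(** For the remainder [y] of [x] modulo [2 pi], [cos y = 1] forces [sin (y / 2) = 0] with [y / 2] in
    [[0, pi)]. *)
Lemma cos_eq1 (x : R) : 0 <= x -> cos x = 1 -> exists j : nat, x = pi *+ 2 * j%:R.
Proof.
move=> x0 cx; have p0 : 0 < (pi : R) *+ 2 by rewrite pmulrn_lgt0// pi_gt0.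
exists (Num.truncn (x / (pi *+ 2))).
set j := Num.truncn _.
have /andP[j1 j2] : j%:R <= x / (pi *+ 2) < j.+1%:R.
  by rewrite truncn_itv// divr_ge0// ltW.
have y0 : 0 <= x - pi *+ 2 * j%:R by rewrite subr_ge0 mulrC -ler_pdivlMr.
have y1 : x - pi *+ 2 * j%:R < pi *+ 2.
  rewrite ltrBlDr -[X in _ < X + _]mulr1 -mulrDr -natr1 in j2 *.
  by rewrite mulrC addrC -ltr_pdivrMr.
set y := x - _ in y0 y1.
have cy : cos y = 1.
  have <- := periodicn (@cosD2pi R) j y.
  by rewrite -mulr_natr subrK.
have s0 : sin (y / 2) = 0.
  have := cosD (y / 2) (y / 2); rewrite -splitr cy -!expr2 cos2sin2 => h.
  by apply/eqP; rewrite -sqrf_eq0; apply/eqP; lra.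
have [y_gt0|] := boolP (0 < y).
  suff : 0 < sin (y / 2) by rewrite s0 ltxx.
  by apply: sin_gt0_pi; apply/andP; split; lra.
rewrite lt_neqAle y0 andbT negbK eq_sym subr_eq0 => /eqP //.
Qed.

(** The inner product of vertices [i] and [i.+2] is invariant, and it is 1 exactly when steps [i]
    and [i.+1] have opposite signs, since [cos (a + a) != 1]. Hence [A'] is [A] or its complement,
    and two majorities exclude the complement. *)
Lemma cpt_inj a A A' (g : 'M[R]_3) : 0 < a < pi ->
  cos (a * turns R A n.+1) = 1 -> cos (a * turns R A' n.+1) = 1 ->
  (n.+1 < #|A|.*2)%N -> (n.+1 < #|A'|.*2)%N -> SO3 g ->
  polymx n (cpt a A') = polymx n (cpt a A) *m g^T -> A = A'.
Proof.
move=> api c1 c1' mA mA' [gg _] E.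
have vE i : (i <= n.+1)%N -> cpt a A' i = cpt a A i *m g^T.
  by move=> lein; rewrite -(vert_cpt c1' lein) -(vert_cpt c1 lein) E /vert row_mul.
have dE i : (i < n)%N -> cos (a * (sgn R A i + sgn R A i.+1)) =
    cos (a * (sgn R A' i + sgn R A' i.+1)).
  move=> ltin; have : dotv (cpt a A' i) (cpt a A' i.+2) =
      dotv (cpt a A i) (cpt a A i.+2).
    by rewrite !vE ?dotv_mul ?trmxK ?(mulmx1C gg)//; lia.
  have tE C : turns R C i + sgn R C i + sgn R C i.+1 - turns R C i =
      sgn R C i + sgn R C i.+1 by ring.
  by rewrite !dotv_cpt !turnsS !tE.
have c2 : cos (a + a) != 1.
  rewrite cosD -!expr2 cos2sin2 -subr_eq0.
  have s0 : sin a != 0 by rewrite gt_eqF// sin_gt0_pi.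
  have -> : 1 - sin a ^+ 2 - sin a ^+ 2 - 1 = - 2 * sin a ^+ 2 by ring.
  by rewrite mulf_neq0// ?expf_neq0// oppr_eq0 pnatr_eq0.
pose m (C : {set 'I_n.+1}) i := (inord i : 'I_n.+1) \in C.
have cosm C i : (cos (a * (sgn R C i + sgn R C i.+1)) == 1) = (m C i != m C i.+1).
  rewrite /sgn -!/(m _ _); case: (m C i); case: (m C i.+1) => /=.
  - by rewrite mulrDr mulr1 (negPf c2).
  - by rewrite subrr mulr0 cos0 eqxx.
  - by rewrite addrC subrr mulr0 cos0 eqxx.
  - by rewrite mulrDr mulrN1 -opprD cosN (negPf c2).
have mE i : (i <= n)%N -> m A' i = m A i (+) (m A 0 (+) m A' 0).
  elim: i => [|i IH] lein; first by case: (m A 0); case: (m A' 0).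
  have := cosm A i; rewrite dE// cosm (IH (ltnW lein)).
  move: (m A 0 (+) m A' 0) => d.
  by case: (m A i); case: (m A i.+1); case: (m A' i.+1); case: d.
have AE (x : 'I_n.+1) : (x \in A') = (x \in A) (+) (m A 0 (+) m A' 0).
  by have := mE x; rewrite /m inord_val => ->//; rewrite -ltnS.
move: AE; case: (_ (+) _) => AE; last by apply/setP => x; rewrite AE addbF.
have A'C : A' = ~: A by apply/setP => x; rewrite AE inE addbT.
by have := cardsC A; rewrite -A'C card_ord; lia.
Qed.

End Planar.

(** * Enumeration of the critical points *)

Lemma card_image_seq (T : eqType) (T' : Type) (f : T -> T') (s : seq T) :
  uniq s -> {in s &, injective f} -> (f @` [set` s] #= `I_(size s))%card.
Proof.
case: s => [|x0 s]; first by rewrite set_nil image_set0 II0.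
set s' := x0 :: s => us fi.
have -> : f @` [set` s'] = (fun i => f (nth x0 s' i)) @` `I_(size s').
  apply/seteqP; split=> [_ [x xs <-]|_ [i ilt <-]].
    by exists (index x s'); [rewrite /mkset index_mem | rewrite nth_index].
  by exists (nth x0 s' i) => //; exact: mem_nth.
apply: inj_card_eq => i j; rewrite !inE => ilt jlt /fi.
move=> /(_ (mem_nth _ ilt) (mem_nth _ jlt)) /eqP.
by rewrite nth_uniq// => /eqP.
Qed.

Section Main.
Variables (R : realType) (m : nat).
Hypothesis m_gt0 : (0 < m)%N.
Let n := m.*2.
Implicit Types (A : {set 'I_n.+1}) (k j : nat).

Definition slope k j : R := pi *+ 2 * j%:R / k%:R.

(** The signed number of steps if [A] has a majority. Otherwise truncation gives 0, and no [j] is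
    admissible. *)
Definition excess A := (#|A|.*2 - n.+1)%N.

Lemma slope_bound k j : (0 < j)%N -> (j.*2 < k)%N -> 0 < slope k j < pi.
Proof.
move=> j0 jk; have k0 : 0 < k%:R :> R by rewrite ltr0n; lia.
have p0 := pi_gt0 R; rewrite /slope; apply/andP; split.
  by rewrite divr_gt0// mulr_gt0// ?ltr0n// pmulrn_lgt0.
rewrite ltr_pdivrMr// mulrnAl -mulrnAr ltr_pM2l//.
by rewrite -mulr_natr -natrM ltr_nat muln2.
Qed.

Lemma slope_eq k j k' j' : (0 < k)%N -> (0 < k')%N ->
  slope k j = slope k' j' <-> (j * k' = j' * k)%N.
Proof.
move=> k0 k0'; rewrite /slope.
have kn : k%:R != 0 :> R by rewrite pnatr_eq0 -lt0n.
have kn' : k'%:R != 0 :> R by rewrite pnatr_eq0 -lt0n.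
have pn : (pi : R) *+ 2 != 0 by rewrite mulrn_eq0 /= gt_eqF ?pi_gt0.
split=> [/eqP|E].
  rewrite -!mulrA (inj_eq (mulfI pn)) eqr_div// -!natrM eqr_nat => /eqP //.
by apply/eqP; rewrite -!mulrA (inj_eq (mulfI pn)) eqr_div// -!natrM E.
Qed.

Lemma turns_excess A : (n.+1 < #|A|.*2)%N -> turns R A n.+1 = (excess A)%:R.
Proof. by move=> h; rewrite turns_full natrB// ltnW. Qed.

Lemma cos_slope A j : (n.+1 < #|A|.*2)%N ->
  cos (slope (excess A) j * turns R A n.+1) = 1.
Proof.
move=> h; rewrite turns_excess// /slope divfK; last first.
  by rewrite pnatr_eq0 /excess; lia.
by rewrite -[_ * _]add0r mulr_natr (periodicn (@cosD2pi R)) cos0.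
Qed.

Definition star A j := (polymx n (cpt (slope (excess A) j) A), slope (excess A) j).

Definition admissible (x : {set 'I_n.+1} * nat) :=
  (0 < x.2)%N && (x.2.*2 < excess x.1)%N.

Lemma star_Bset A j : admissible (A, j) -> star A j \in @Bset R n.+1.
Proof.
move=> /andP[/= j0 jk]; apply/mem_set/cpt_Bset; first exact: slope_bound.
by apply: cos_slope; move: jk; rewrite /excess; lia.
Qed.

(** [P0] is the default of [insubd], never returned for an admissible pair. *)
Definition star_class (P0 : B R n.+1) (x : {set 'I_n.+1} * nat) : X R n.+1 :=
  \pi_(X R n.+1) (insubd P0 (star x.1 x.2)).

Lemma star_val P0 A j : admissible (A, j) ->
  val (insubd P0 (star A j) : B R n.+1) = star A j.
Proof. by move=> h; rewrite val_insubd star_Bset. Qed.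

Lemma mu_star P0 A j : admissible (A, j) ->
  mu (star_class P0 (A, j)) = slope (excess A) j.
Proof. by move=> h; rewrite /star_class mu_pi star_val. Qed.

(** The closing condition [cos (a * k) = 1] of a planar polygon gives [a = 2 pi j / k], and
    [0 < a < pi] then reads [0 < 2j < k]. *)
Lemma U_star P0 : U R n.+1 = star_class P0 @` [set x | admissible x].
Proof.
apply/seteqP; split=> [x Ux|_ [[A j] h <-]]; last first.
  have /andP[/= j0 jk] := h.
  have hA : (n.+1 < #|A|.*2)%N by move: jk; rewrite /excess; lia.
  have h' := star_val P0 h.
  apply: (@cpt_critical _ _ _ A); rewrite /edge ?/pts ?h' //=.
    exact: cos_slope.
  by rewrite turns_excess// pnatr_eq0; lia.
have [P xP] : exists P, x = \pi_(X R n.+1) P by exists (repr x); rewrite reprK.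
move: Ux; rewrite /U /= xP => /critical_planar /planar_cpt_maj.
have /[swap] /[apply] : ~~ odd n by rewrite odd_double.
move=> [A [hA c1 [g Sg gE]]].
have /andP[a0 api] := edge_bound P.
have k0 : (0 < excess A)%N by rewrite /excess; lia.
have k0R : (excess A)%:R != 0 :> R by rewrite pnatr_eq0 -lt0n.
move: c1; rewrite turns_excess// => /cos_eq1[|j aj].
  by rewrite mulr_ge0// ltW.
have aE : edge P = slope (excess A) j by rewrite /slope -aj mulfK.
have adm : admissible (A, j).
  rewrite /admissible /=; apply/andP; split.
    rewrite lt0n; apply/eqP => j0; move: a0; rewrite aE /slope j0 mulr0 mul0r ltxx //.
  have : edge P * (excess A)%:R < pi * (excess A)%:R by rewrite ltr_pM2r// ltr0n.
  by rewrite aj mulrnAl -mulrnAr ltr_pM2l ?pi_gt0// -mulr_natr -natrM ltr_nat muln2.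
exists (A, j) => //; apply/esym/pi_eqP; exists g => //.
by rewrite /pts /edge star_val// /star /= -aE gE.
Qed.

(** [mu] recovers the slope, then [cpt_inj] recovers [A], hence [k] and [j]. *)
Lemma star_inj P0 : {in [set x | admissible x] &, injective (star_class P0)}.
Proof.
move=> [A j] [A' j']; rewrite !inE /= => h h' E.
have := congr1 (@mu R n.+1) E; rewrite !mu_star// => sE.
have /pi_eqP[g Sg] := E; rewrite /pts /edge !star_val//= => -[gE _].
have /andP[/= j0 jk] := h; have /andP[/= j0' jk'] := h'.
have hA : (n.+1 < #|A|.*2)%N by move: jk; rewrite /excess; lia.
have hA' : (n.+1 < #|A'|.*2)%N by move: jk'; rewrite /excess; lia.
have AA : A = A'.
  apply: (cpt_inj (slope_bound j0 jk) _ _ hA hA' Sg).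
  - exact: cos_slope.
  - by rewrite sE; exact: cos_slope.
  - by rewrite [in LHS]sE.
rewrite AA in sE *; congr (_, _).
have k0 : (0 < excess A')%N by rewrite /excess; lia.
by move/slope_eq: sE => /(_ k0 k0) /eqP; rewrite eqn_pmul2r// => /eqP.
Qed.

Lemma B_inhabited : inhabited (B R n.+1).
Proof.
(* The regular polygon going once around the equator: all steps forward, [k = 2m + 1], [j = 1]. *)
have h : admissible ([set: 'I_n.+1]%SET, 1%N).
  rewrite /admissible /excess cardsT card_ord /= /n; lia.
exact: inhabits (SigSub (star_Bset h)).
Qed.

Lemma card_U : (U R n.+1 #= `I_(\sum_(A : {set 'I_n.+1}) (excess A)./2))%card.
Proof.
have [P0] := B_inhabited.
pose s := [seq (A, j) | A <- enum {set 'I_n.+1}, j <- iota 1 (excess A)./2].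
have us : uniq s.
  apply: allpairs_uniq_dep; first exact: enum_uniq.
    by move=> A _; exact: iota_uniq.
  by move=> [A j] [A' j'] _ _ /= [-> ->].
(* A positive excess [k] is odd, so [2j < k] amounts to [j <= k./2]. *)
have sE : [set x | admissible x] = [set` s].
  apply/seteqP; split=> [[A j] /andP[/= j0 jk]|[A j] /allpairsPdep[A' [j' [_]]]].
    apply/allpairsPdep; exists A, j; split; rewrite ?mem_enum// mem_iota.
    by lia.
  rewrite mem_iota => jk [-> ->]; rewrite /= /admissible /=.
  by move: jk; rewrite /excess /n; lia.
have sz : size s = \sum_(A : {set 'I_n.+1}) (excess A)./2.
  rewrite size_allpairs_dep sumnE big_map big_enum /=.
  by apply: eq_bigr => A _; rewrite size_iota.
rewrite -sz (U_star P0) sE; apply: card_image_seq => //.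
have := @star_inj P0; rewrite sE => h x y xs ys.
by apply: h; rewrite inE.
Qed.

(** Cancelling [gcdn k j] leaves an odd denominator [2s + 1], and [2j < 2s + 1] becomes [j <= s].
    Conversely, any set of [m + 1 + s] steps has excess [2s + 1]. *)
Lemma V_slope : V R n.+1 = (fun x => slope x.1.*2.+1 x.2) @`
  [set x : nat * nat | [&& (0 < x.2)%N, (x.2 <= x.1)%N, (x.1 <= m)%N & coprime x.1.*2.+1 x.2]].
Proof.
have [P0] := B_inhabited.
rewrite /V (U_star P0) image_comp; apply/seteqP; split=> [_ [[A j] h <-]|_ [[s j] /= /and4P[j0 js sm co] <-]].
  rewrite /= mu_star//.
  have /andP[/= j0 jk] := h.
  have k0 : (0 < excess A)%N by lia.
  set k := excess A in jk k0 *; set d := gcdn k j.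
  have d0 : (0 < d)%N by rewrite gcdn_gt0 k0.
  have [dk dj] : (k = k %/ d * d)%N /\ (j = j %/ d * d)%N.
    by rewrite !divnK// (dvdn_gcdl, dvdn_gcdr).
  have kn : (k <= n.+1)%N.
    have : (#|A| <= n.+1)%N by rewrite -[X in (_ <= X)%N]card_ord max_card.
    by rewrite /k /excess; lia.
  have ok : odd k.
    have hA : (n.+1 <= #|A|.*2)%N by move: k0; rewrite /k /excess; lia.
    by rewrite /k /excess oddB// odd_double /= /n odd_double.
  have ok2 : odd (k %/ d) by move: ok; rewrite [in odd k]dk oddM => /andP[].
  have kE : ((k %/ d)./2.*2.+1 = k %/ d)%N by rewrite -[RHS]odd_double_half ok2.
  have j0' : (0 < j %/ d)%N by move: j0; rewrite {1}dj muln_gt0 => /andP[].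
  have jk' : ((j %/ d).*2 < k %/ d)%N.
    by move: jk; rewrite [in j.*2]dj {1}dk doubleMl ltn_pmul2r.
  have kd : (k %/ d <= k)%N by exact: leq_div.
  exists ((k %/ d)./2, (j %/ d)%N) => /=.
    rewrite kE; apply/and4P; split=> //; rewrite /n in kn *; try lia.
    rewrite /coprime -(eqn_pmul2r d0) mul1n muln_gcdl -dk -dj //.
  rewrite kE; apply/slope_eq => //; first by lia.
  by rewrite [X in (_ * X)%N = _]dk mulnCA -dj mulnC.
have le : (m.+1 + s <= n.+1)%N by rewrite /n; lia.
pose A := imset (widen_ord le) (mem 'I_(m.+1 + s)).
have cA : #|A| = (m.+1 + s)%N.
  rewrite card_imset ?card_ord// => x y /(congr1 val) /=; exact: val_inj.
have kA : excess A = s.*2.+1 by rewrite /excess cA /n; lia.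
have h : admissible (A, j) by rewrite /admissible /= kA; lia.
by exists (A, j) => //=; rewrite mu_star// kA.
Qed.

(** Reduced fractions have distinct slopes: by Gauss's lemma, equal slopes make the denominators
    divide each other. *)
Lemma card_V : (V R n.+1 #=
  `I_(\sum_(1 <= s < m.+1) size [seq j <- iota 1 s | coprime s.*2.+1 j]))%card.
Proof.
pose t := [seq (s, j) | s <- iota 1 m, j <- [seq j <- iota 1 s | coprime s.*2.+1 j]].
have ut : uniq t.
  apply: allpairs_uniq_dep; first exact: iota_uniq.
    by move=> A _; rewrite filter_uniq// iota_uniq.
  by move=> [A j] [A' j'] _ _ /= [-> ->].
have tP (x : nat * nat) : x \in t =
   [&& (0 < x.2)%N, (x.2 <= x.1)%N, (x.1 <= m)%N & coprime x.1.*2.+1 x.2].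
  case: x => s j; apply/allpairsPdep/and4P => /= [[s' [j' [+ + [-> ->]]]]|[j0 js sm co]].
    by rewrite mem_filter !mem_iota => ? /andP[-> ?]; split=> //; lia.
  by exists s, j; rewrite mem_filter co !mem_iota; split=> //; lia.
have sz : size t = (\sum_(1 <= s < m.+1) size [seq j <- iota 1 s | coprime s.*2.+1 j])%N.
  by rewrite size_allpairs_dep sumnE big_map /index_iota subn1.
rewrite -sz V_slope.
have -> : [set x : nat * nat | [&& (0 < x.2)%N, (x.2 <= x.1)%N, (x.1 <= m)%N
    & coprime x.1.*2.+1 x.2]] = [set` t].
  by apply/seteqP; split=> x /=; rewrite tP.
apply: card_image_seq => // -[s j] [s' j'].
rewrite !tP /= => /and4P[j0 js sm co] /and4P[j0' js' sm' co'].
move/slope_eq => /(_ isT isT) E.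
have d1 : (s.*2.+1 %| s'.*2.+1)%N.
  by rewrite -(Gauss_dvdr _ co) E dvdn_mull.
have d2 : (s'.*2.+1 %| s.*2.+1)%N.
  by rewrite -(Gauss_dvdr _ co') -E dvdn_mull.
have ss : s = s' by have /eqP : s.*2.+1 == s'.*2.+1; [rewrite eqn_dvd d1 | lia].
by move: E; rewrite ss => /eqP; rewrite eqn_pmul2r// => /eqP ->.
Qed.

End Main.

Unset Implicit Arguments.

Theorem propositionC (R : realType) (n m : nat) (hn : n = (2 * m + 1)%N)
    (hn3 : (3 <= n)%N) :
  (exists2 N : nat, (U R n #= `I_N)%card
     & N%:R = 2%:R^-1 * (- 4%:R ^+ m + ((2 * m + 1)`!)%:R / (m`!)%:R ^+ 2)
         :> rat) /\
  (exists2 N : nat, (V R n #= `I_N)%card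
     & N%:R = 2%:R^-1 * \sum_(1 <= s < m.+1) (totient (2 * s + 1))%:R
         :> rat).
Proof.
have m_gt0 : (0 < m)%N by lia.
have nE : n = m.*2.+1 by lia.
rewrite nE; split.
  exists (\sum_(A : {set 'I_m.*2.+1}) (excess A)./2)%N; first exact: card_U.
  exact: excess_closed_form.
exists (\sum_(1 <= s < m.+1) size [seq j <- iota 1 s | coprime s.*2.+1 j])%N.
  exact: card_V.
have -> : \sum_(1 <= s < m.+1) (totient (2 * s + 1))%:R =
    2%:R * (\sum_(1 <= s < m.+1) size [seq j <- iota 1 s | coprime s.*2.+1 j])%:R :> rat.
  rewrite natr_sum mulr_sumr; apply: eq_big_nat => s /andP[s0 _].
  by rewrite half_totient// -mul2n natrM.
by rewrite mulKf.
Qed.
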